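(* The functor $\mathcal{F}^{\mathrm{OpSem}}_{\mathrm{OpSet}}$ from operated sets to operated semigroups, $(X,P_X)\mapsto(\mathcal{F}(X),P_{\mathcal{F}(X)})$, is left adjoint to the forgetful functor $\mathcal{U}^{\mathrm{OpSem}}_{\mathrm{OpSet}}$ from operated semigroups to operated sets.
   Context: An operated set is a set $X$ with a map $P_X:X\to X$; an operated semigroup is a semigroup $S$ with a map $P_S:S\to S$ (not necessarily a homomorphism). Morphisms are maps (resp. semigroup homomorphisms) commuting with the given self-maps. For a set $U$, $\mathcal{S}(U)$ is the free semigroup on $U$, and $\lfloor U\rfloor$ is the set of formal elements $\lfloor u\rfloor$, $u\in U$ (a disjoint copy of $U$). Let $(X,P_X)$ be an operated set. Put $\mathcal{F}_0(X)=\mathcal{S}(X)$ and, for $n\ge1$, $\mathcal{F}_n(X)=\mathcal{S}(X\sqcup\lfloor\mathcal{F}_{n-1}(X)\setminus X\rfloor)$, where $X$ is regarded as a subset of $\mathcal{F}_{n-1}(X)$ via one-letter words. Let $i_{0,1}:\mathcal{F}_0(X)\hookrightarrow\mathcal{F}_1(X)$ be the homomorphism induced by the inclusion $X\hookrightarrow X\sqcup\lfloor\mathcal{S}(X)\setminus X\rfloor$, and for $n\ge2$ let $i_{n-1,n}:\mathcal{F}_{n-1}(X)\hookrightarrow\mathcal{F}_n(X)$ be induced by the injection $\mathrm{Id}_X\sqcup\lfloor i_{n-2,n-1}|_{\mathcal{F}_{n-2}(X)\setminus X}\rfloor$ from $X\sqcup\lfloor\mathcal{F}_{n-2}(X)\setminus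 X\rfloor$ to $X\sqcup\lfloor\mathcal{F}_{n-1}(X)\setminus X\rfloor$. Let $\mathcal{F}(X)=\varinjlim\mathcal{F}_n(X)$, with the induced injections $i_n:\mathcal{F}_n(X)\hookrightarrow\mathcal{F}(X)$ and $i:X\hookrightarrow\mathcal{F}(X)$. The operator is $$P_{\mathcal{F}(X)}(u)=\begin{cases} i(P_X(x)) & \text{if } u=i(x)\text{ for some }x\in X,\\ i_{k+1}(\lfloor u'\rfloor) & \text{if } u\notin i(X)\text{ and } u=i_k(u')\text{ for some }u'\in\mathcal{F}_k(X).\end{cases}$$ On morphisms the functor is defined by the evident functoriality of the construction. *)

(* Defs.v *)
From HB Require Import structures.
From mathcomp Require Import all_boot.
From mathcomp Require Import boolp.

Set Implicit Arguments.
Unset Strict Implicit.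
Unset Printing Implicit Defensive.

Local Open Scope group_scope.
Local Open Scope quotient_scope.

Record category := Category {
  obj :> Type;
  hom : obj -> obj -> Type;
  idm : forall a, hom a a;
  comp : forall a b c, hom b c -> hom a b -> hom a c;
  comp1m : forall a b (f : hom a b), comp (idm b) f = f;
  compm1 : forall a b (f : hom a b), comp f (idm a) = f;
  compA : forall a b c d (h : hom c d) (g : hom b c) (f : hom a b),
    comp h (comp g f) = comp (comp h g) f }.

Arguments hom {_} _ _.
Arguments idm {_} _.
Arguments comp {_ _ _ _} _ _.

Record functor (C D : category) := Functor {
  fobj :> C -> D;
  fhom : forall a b, hom a b -> hom (fobj a) (fobj b);
  fhom1 : forall a, fhom (idm a) = idm (fobj a);
  fhomM : forall a b c (g : hom b c) (f : hom a b),
    fhom (comp g f) = comp (fhom g) (fhom f) }.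

Arguments fhom {C D} _ {a b} _.

Definition left_adjoint (C D : category) (F : functor C D) (G : functor D C) :=
  exists phi : forall c d, hom (F c) d -> hom c (G d),
    (forall c d, bijective (phi c d)) /\
    (forall c c' d d' (h : hom c' c) (k : hom d d') (f : hom (F c) d),
       phi c' d' (comp k (comp f (fhom F h)))
         = comp (fhom G k) (comp (phi c d f) h)).

(* Carriers are choiceTypes, the base of the semigroupType hierarchy. With the
   axioms of boolp every type is one, and morphisms ignore the choice structure,
   so these are the categories of all operated sets and semigroups. *)

HB.mixin Record hasOperator T := { op : T -> T }.

#[short(type="opSetType")]
HB.structure Definition OpSet := {T of hasOperator T & Choice T}.

#[short(type="opSemigroupType")]
HB.structure Definition OpSemigroup := {T of hasOperator T & Semigroup T}.

Record opset_hom (X Y : opSetType) := OpSetHom {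
  opset_fun :> X -> Y;
  opset_homP : {morph opset_fun : x / op x} }.

Record opsem_hom (S T : opSemigroupType) := OpSemHom {
  opsem_fun :> S -> T;
  opsem_homM : {morph opsem_fun : x y / x * y};
  opsem_homP : {morph opsem_fun : x / op x} }.

Lemma opset_hom_eq (X Y : opSetType) (f g : opset_hom X Y) : f =1 g -> f = g.
Proof.
case: f g => [f fP] [g gP] /= /funext fg; move: fP gP; rewrite fg => fP gP.
by rewrite (Prop_irrelevance fP gP).
Qed.

Lemma opsem_hom_eq (S T : opSemigroupType) (f g : opsem_hom S T) :
  f =1 g -> f = g.
Proof.
case: f g => [f fM fP] [g gM gP] /= /funext fg.
move: fM fP gM gP; rewrite fg => fM fP gM gP.
by rewrite (Prop_irrelevance fM gM) (Prop_irrelevance fP gP).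
Qed.

Definition opset_id (X : opSetType) : opset_hom X X :=
  @OpSetHom X X id (fun=> erefl).

Lemma opset_comp_subproof (X Y Z : opSetType) (g : opset_hom Y Z)
  (f : opset_hom X Y) : {morph g \o f : x / op x}.
Proof. by move=> x /=; rewrite !opset_homP. Qed.

Definition opset_comp (X Y Z : opSetType) (g : opset_hom Y Z)
  (f : opset_hom X Y) : opset_hom X Z := OpSetHom (opset_comp_subproof g f).

Definition opsem_id (S : opSemigroupType) : opsem_hom S S :=
  @OpSemHom S S id (fun _ _ => erefl) (fun=> erefl).

Lemma opsem_comp_subproofM (S T U : opSemigroupType) (g : opsem_hom T U)
  (f : opsem_hom S T) : {morph g \o f : x y / x * y}.
Proof. by move=> x y /=; rewrite !opsem_homM. Qed.

Lemma opsem_comp_subproofP (S T U : opSemigroupType) (g : opsem_hom T U)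
  (f : opsem_hom S T) : {morph g \o f : x / op x}.
Proof. by move=> x /=; rewrite !opsem_homP. Qed.

Definition opsem_comp (S T U : opSemigroupType) (g : opsem_hom T U)
  (f : opsem_hom S T) : opsem_hom S U :=
  OpSemHom (opsem_comp_subproofM g f) (opsem_comp_subproofP g f).

Definition OpSetCat : category.
Proof.
refine (@Category opSetType opset_hom opset_id opset_comp _ _ _);
  by move=> *; apply: opset_hom_eq.
Defined.

Definition OpSemCat : category.
Proof.
refine (@Category opSemigroupType opsem_hom opsem_id opsem_comp _ _ _);
  by move=> *; apply: opsem_hom_eq.
Defined.

Definition opsem_forget (S T : opSemigroupType) (f : opsem_hom S T) :
  opset_hom S T := OpSetHom (opsem_homP f).

Definition forgetful : functor OpSemCat OpSetCat.
Proof.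
refine (@Functor OpSemCat OpSetCat (fun S : opSemigroupType => S : opSetType)
          opsem_forget _ _); by move=> *; apply: opset_hom_eq.
Defined.

Section Word.
Variable U : choiceType.

Record word := Word { word_seq :> seq U; word_neq0 : ~~ nilp word_seq }.

HB.instance Definition _ := [isSub for word_seq].
HB.instance Definition _ := [Choice of word by <:].

Lemma word_seq_inj : injective word_seq.
Proof. exact: val_inj. Qed.

Lemma word_mul_subproof (u v : word) : ~~ nilp (u ++ v).
Proof. by case: u => -[]. Qed.

Definition word_mul (u v : word) : word := Word (word_mul_subproof u v).

Lemma word_mulA : associative word_mul.
Proof. by move=> u v w; apply/val_inj; rewrite /= catA. Qed.

HB.instance Definition _ := isSemigroup.Build word word_mulA.

Definition word1 (a : U) : word := @Word [:: a] isT.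

End Word.

Section WordMap.
Variables (U V : choiceType) (g : U -> V).

Lemma word_map_subproof (u : word U) : ~~ nilp (map g u).
Proof. by case: u => -[]. Qed.

Definition word_map (u : word U) : word V := Word (word_map_subproof u).

Lemma word_mapM : {morph word_map : u v / u * v}.
Proof. by move=> u v; apply/val_inj; rewrite /= map_cat. Qed.

HB.instance Definition _ :=
  isMultiplicative.Build (word U) (word V) word_map word_mapM.

End WordMap.

Section DirLim.
Variables (S : nat -> semigroupType).
Variable f : forall n, {multiplicative S n -> S n.+1}.

Definition shift (x : {n & S n}) : {n & S n} :=
  Tagged S (f (tag x) (tagged x)).

(* Equality of iterated shifts in {n & S n} forces p + tag x = q + tag y:
   x and y are identified when they have the same image at some stage. *)
Definition dl_rel (x y : {n & S n}) : bool :=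
  `[< exists p q, iter p shift x = iter q shift y >].

Lemma dl_rel_refl : reflexive dl_rel.
Proof. by move=> x; apply/asboolP; exists 0%N, 0%N. Qed.

Lemma dl_rel_sym : symmetric dl_rel.
Proof. by move=> x y; apply/asboolP/asboolP => -[p [q e]]; exists q, p. Qed.

Lemma dl_rel_trans : transitive dl_rel.
Proof.
move=> y x z /asboolP[p [q e]] /asboolP[p' [q' e']]; apply/asboolP.
exists (p' + p)%N, (q + q')%N.
by rewrite !iterD e -e' -!iterD addnC.
Qed.

Canonical dl_equiv := EquivRel dl_rel dl_rel_refl dl_rel_sym dl_rel_trans.

Definition dirlim : Type := {eq_quot dl_equiv}.

HB.instance Definition _ := Choice.on dirlim.
HB.instance Definition _ := Quotient.on dirlim.

Definition dl_in n (u : S n) : dirlim := \pi_dirlim (Tagged S u).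

Lemma dl_in_repr (u : dirlim) : dl_in (tagged (repr u)) = u.
Proof. by rewrite /dl_in; case: (repr u) (reprK u). Qed.

Lemma dl_inP m n (u : S m) (v : S n) : dl_in u = dl_in v <->
  exists p q, iter p shift (Tagged S u) = iter q shift (Tagged S v).
Proof.
split=> [/(@eqmodP _ dl_equiv) /asboolP //|h].
by apply/(@eqmodP _ dl_equiv)/asboolP.
Qed.

Lemma dl_inS n (u : S n) : dl_in (f n u) = dl_in u.
Proof. by apply/dl_inP; exists 0%N, 1%N. Qed.

Fixpoint dl_up p n (u : S n) : S (p + n) :=
  if p is p'.+1 then f (p' + n) (dl_up p' u) else u.

Lemma dl_upE p n (u : S n) : iter p shift (Tagged S u) = Tagged S (dl_up p u).
Proof. by elim: p => //= p ->. Qed.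

Lemma dl_upM p n : {morph @dl_up p n : u v / u * v}.
Proof. by elim: p => //= p ih u v; rewrite ih gmulfM. Qed.

Lemma dl_in_up p n (u : S n) : dl_in (dl_up p u) = dl_in u.
Proof. by elim: p => //= p ih; rewrite dl_inS. Qed.

Lemma dl_in_leq m n (u : S m) : m <= n -> exists v : S n, dl_in v = dl_in u.
Proof.
move=> le_mn; rewrite -(subnK le_mn); exists (dl_up (n - m) u).
exact: dl_in_up.
Qed.

Lemma dl_common (u v : dirlim) : exists w : {n & (S n * S n)%type},
  dl_in (tagged w).1 = u /\ dl_in (tagged w).2 = v.
Proof.
set m := tag (repr u); set n := tag (repr v).
have [u' eu] := dl_in_leq (tagged (repr u)) (leq_maxl m n).
have [v' ev] := dl_in_leq (tagged (repr v)) (leq_maxr m n).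
exists (Tagged (fun n => (S n * S n)%type) (u', v')) => /=.
by rewrite eu ev !dl_in_repr.
Qed.

Definition dl_mul (u v : dirlim) : dirlim :=
  let w := sval (cid (dl_common u v)) in
  dl_in ((tagged w).1 * (tagged w).2).

Lemma dl_mul_wd m n (u v : S m) (u' v' : S n) :
  dl_in u = dl_in u' -> dl_in v = dl_in v' -> dl_in (u * v) = dl_in (u' * v').
Proof.
move=> /dl_inP[p [q e]] /dl_inP[p' [q' e']].
have {}e : iter (p' + p) shift (Tagged S u) = iter (p' + q) shift (Tagged S u').
  by rewrite !iterD e.
have {}e' : iter (p' + p) shift (Tagged S v) = iter (p + q') shift (Tagged S v').
  by rewrite addnC !iterD e'.
have eq : (p' + q = p + q')%N.
  move: e e'; rewrite !dl_upE => /(congr1 tag)/= e /(congr1 tag)/= e'.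
  by apply: (@addIn n); rewrite -e -e'.
move: e e'; rewrite -eq; move: (p' + p)%N (p' + q)%N => {p p' q q' eq} p q.
rewrite !dl_upE => eu ev.
rewrite -(dl_in_up p) -(dl_in_up q (u' * v')) !dl_upM.
move: (dl_up p u) (dl_up p v) (dl_up q u') (dl_up q v') eu ev => a b a' b' ea eb.
have := congr1 tag ea; rewrite /= => emn.
case: _ / emn a' b' ea eb => a' b' ea eb.
by rewrite (eq_from_Tagged ea) (eq_from_Tagged eb).
Qed.

Lemma dl_inM n : {morph @dl_in n : u v / u * v >-> dl_mul u v}.
Proof.
move=> u v; rewrite /dl_mul.
by case: cid => -[m [u' v']] /= [eu ev]; apply: dl_mul_wd.
Qed.

Lemma dl_mulA : associative dl_mul.
Proof.
move=> u v w.
have [[m [u' v']] /= [<- <-]] := dl_common u v.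
rewrite -(dl_in_repr w).
have [u'' <-] := dl_in_leq u' (leq_maxl m (tag (repr w))).
have [v'' <-] := dl_in_leq v' (leq_maxl m (tag (repr w))).
have [w'' <-] := dl_in_leq (tagged (repr w)) (leq_maxr m (tag (repr w))).
by rewrite -!dl_inM mulgA.
Qed.

HB.instance Definition _ := isSemigroup.Build dirlim dl_mulA.
HB.instance Definition _ n :=
  isMultiplicative.Build (S n) dirlim (@dl_in n) (@dl_inM n).

Definition dl_lift (T : Type) (g : forall n, S n -> T) (u : dirlim) : T :=
  g (tag (repr u)) (tagged (repr u)).

Lemma dl_lift_in (T : Type) (g : forall n, S n -> T) n (u : S n) :
  (forall n (v : S n), g n.+1 (f n v) = g n v) -> dl_lift g (dl_in u) = g n u.
Proof.
move=> gf; have gi p (x : {n & S n}) :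
    g _ (tagged (iter p shift x)) = g _ (tagged x).
  by elim: p => //= p <-; rewrite gf.
have /dl_inP[p [q e]] := dl_in_repr (dl_in u).
rewrite /dl_lift; transitivity (g _ (tagged (iter p shift (repr (dl_in u))))).
  by rewrite gi.
rewrite -(gi q (Tagged S u)) -e; congr (g _ (tagged (iter p shift _))).
by case: repr.
Qed.

End DirLim.

(* [alphabet X] is a set of letters into which X is embedded by [var]; the n-th
   semigroup F_n(X) is the set of words on the n-th alphabet. *)
Record alphabet (X : choiceType) := Alphabet {
  letter :> choiceType;
  var : X -> letter }.

Arguments var {X} _ _.

Definition in_X (X : choiceType) (A : alphabet X) (w : word A) : bool :=
  `[< exists x, w = word1 (var A x) >].

Definition bracket (X : choiceType) (A : alphabet X) : choiceType :=
  {w : word A | ~~ in_X w}.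

Definition next (X : choiceType) (A : alphabet X) : alphabet X :=
  @Alphabet X (X + bracket A)%type inl.

Fixpoint alph (X : choiceType) (n : nat) : alphabet X :=
  if n is n'.+1 then next (alph X n') else @Alphabet X X id.

(* Maps of alphabets lying over phi : X -> Y that send words outside X to words
   outside Y, so that they restrict to brackets. *)
Record alph_map (X Y : choiceType) (phi : X -> Y) (A : alphabet X)
    (B : alphabet Y) := AlphMap {
  alph_fun :> A -> B;
  alph_map_var : forall x, alph_fun (var A x) = var B (phi x);
  alph_map_out : forall w : word A, ~~ in_X w -> ~~ in_X (word_map alph_fun w) }.

Section Next.
Variables (X Y : choiceType) (phi : X -> Y) (A : alphabet X) (B : alphabet Y).
Variable g : alph_map phi A B.

Definition bracket_map (b : bracket A) : bracket B :=
  exist _ (word_map g (sval b)) (alph_map_out g (svalP b)).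

Definition next_fun (a : next A) : next B :=
  match a with inl x => inl (phi x) | inr b => inr (bracket_map b) end.

Lemma next_fun_out (w : word (next A)) :
  ~~ in_X w -> ~~ in_X (word_map next_fun w).
Proof.
apply: contra => /asboolP[y /(congr1 val)/=].
case: w => -[//|[x|b] [|//]] //= i _; apply/asboolP; exists x.
exact/val_inj.
Qed.

Definition next_map : alph_map phi (next A) (next B) :=
  @AlphMap X Y phi (next A) (next B) next_fun (fun=> erefl) next_fun_out.

End Next.

Lemma alph_in0_out (X : choiceType) (w : word (alph X 0)) :
  ~~ in_X w -> ~~ in_X (word_map (inl : alph X 0 -> alph X 1) w).
Proof.
apply: contra => /asboolP[y /(congr1 val)/=].
case: w => -[//|x [|//]] //= i _; apply/asboolP; exists x.
exact/val_inj.
Qed.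

Fixpoint alph_in (X : choiceType) n : alph_map id (alph X n) (alph X n.+1) :=
  match n with
  | 0 => @AlphMap X X id (alph X 0) (alph X 1) inl (fun=> erefl)
           (@alph_in0_out X)
  | n'.+1 => next_map (alph_in X n')
  end.

Definition F_ (X : choiceType) (n : nat) : semigroupType := word (alph X n).

Definition F_in (X : choiceType) (n : nat) :
  {multiplicative F_ X n -> F_ X n.+1} := word_map (alph_in X n).

Definition F (X : choiceType) : Type := dirlim (F_in X).

HB.instance Definition _ (X : choiceType) := Semigroup.on (F X).

Definition F_incl (X : choiceType) (n : nat) (w : F_ X n) : F X :=
  dl_in (F_in X) w.

Definition F_var (X : choiceType) (x : X) : F X :=
  F_incl (word1 x : F_ X 0).

Definition F_bracket (X : choiceType) (n : nat) (w : F_ X n)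
  (wX : ~~ in_X w) : F_ X n.+1 :=
  word1 (inr (exist _ w wX) : alph X n.+1).

Lemma F_incl_var (X : choiceType) n (x : X) :
  F_incl (word1 (var (alph X n) x) : F_ X n) = F_var x.
Proof.
elim: n => // n <-; rewrite /F_incl -[RHS]dl_inS; congr dl_in.
by apply/val_inj; rewrite /= alph_map_var.
Qed.

Lemma F_notin_X (X : choiceType) n (w : F_ X n) :
  (~ exists x, F_incl w = F_var x) -> ~~ in_X w.
Proof.
move=> h; apply/negP => /asboolP[x ew]; apply: h; exists x.
by rewrite ew F_incl_var.
Qed.

Lemma F_notin_X_repr (X : choiceType) (u : F X) :
  (~ exists x, u = F_var x) -> ~~ in_X (tagged (repr u) : F_ X (tag (repr u))).
Proof. by move=> h; apply: F_notin_X; rewrite /F_incl dl_in_repr. Qed.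

(* For u outside X, a representative of u is chosen; F_op_bracket shows that any
   representative gives the same value. *)
Definition F_op (X : opSetType) (u : F X) : F X :=
  match pselect (exists x, u = F_var x) with
  | left uX => F_var (op (sval (cid uX)))
  | right uX => F_incl (F_bracket (F_notin_X_repr uX))
  end.

HB.instance Definition _ (X : opSetType) := hasOperator.Build (F X) (@F_op X).

Lemma F_bracketS (X : choiceType) n (w : F_ X n) (wX : ~~ in_X w) :
  F_in X n.+1 (F_bracket wX) = F_bracket (alph_map_out (alph_in X n) wX).
Proof. apply: word_seq_inj; congr [:: inr _]. exact: val_inj. Qed.

Lemma alph_var_inj (X : choiceType) n : injective (var (alph X n)).
Proof. by case: n => [|n] x y // [->]. Qed.

Definition F_unvar (X : choiceType) n (w : F_ X n) : option X :=
  if pselect (exists x, w = word1 (var (alph X n) x)) is left e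
  then Some (sval (cid e)) else None.

Lemma F_unvar_var (X : choiceType) n x :
  F_unvar (word1 (var (alph X n) x) : F_ X n) = Some x.
Proof.
rewrite /F_unvar; case: pselect => [e|[]]; last by exists x.
by case: cid => y /= [/alph_var_inj ->].
Qed.

Lemma F_unvar_out (X : choiceType) n (w : F_ X n) :
  ~~ in_X w -> F_unvar w = None.
Proof. by move=> /asboolPn h; rewrite /F_unvar; case: pselect. Qed.

Lemma F_unvarS (X : choiceType) n (w : F_ X n) :
  F_unvar (F_in X n w) = F_unvar w.
Proof.
have [/asboolP[x ->]|wX] := boolP (in_X w); last first.
  by rewrite !F_unvar_out //; apply: alph_map_out.
rewrite F_unvar_var -(F_unvar_var n.+1 x); congr F_unvar.
by apply: word_seq_inj; rewrite /= alph_map_var.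
Qed.

Definition unvar (X : choiceType) : F X -> option X :=
  dl_lift (@F_unvar X).

Lemma unvar_incl (X : choiceType) n (w : F_ X n) :
  unvar (F_incl w) = F_unvar w.
Proof. by apply: dl_lift_in; apply: F_unvarS. Qed.

Lemma F_var_inj (X : choiceType) : injective (@F_var X).
Proof.
move=> x y /(congr1 (@unvar X)); rewrite !unvar_incl.
by rewrite !(@F_unvar_var X 0) => -[].
Qed.

Lemma F_incl_out (X : choiceType) n (w : F_ X n) :
  ~~ in_X w -> ~ exists x, F_incl w = F_var x.
Proof.
move=> wX [x /(congr1 (@unvar X))].
by rewrite !unvar_incl F_unvar_out // (@F_unvar_var X 0).
Qed.

Lemma F_op_var (X : opSetType) (x : X) : op (F_var x) = F_var (op x).
Proof.
rewrite /op /= /F_op; case: pselect => [e|[]]; last by exists x.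
by case: cid => y /= /F_var_inj ->.
Qed.

Definition F_br (X : choiceType) n (w : F_ X n) : option (F X) :=
  if pselect (~~ in_X w) is left wX then Some (F_incl (F_bracket wX)) else None.

Lemma F_br_out (X : choiceType) n (w : F_ X n) (wX : ~~ in_X w) :
  F_br w = Some (F_incl (F_bracket wX)).
Proof.
rewrite /F_br; case: pselect => // wX'.
by rewrite (bool_irrelevance wX wX').
Qed.

Lemma F_brS (X : choiceType) n (w : F_ X n) : F_br (F_in X n w) = F_br w.
Proof.
have [wX|wX] := boolP (in_X w).
  have wX' : in_X (F_in X n w).
    move: wX => /asboolP[x ->]; apply/asboolP; exists x.
    by apply: word_seq_inj; rewrite /= alph_map_var.
  by rewrite /F_br; case: pselect => [/negP[]|_] //; case: pselect => [/negP[]|_].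
rewrite (F_br_out wX) (F_br_out (alph_map_out (alph_in X n) wX)).
by congr Some; rewrite -F_bracketS /F_incl dl_inS.
Qed.

Lemma F_op_bracket (X : opSetType) n (w : F_ X n) (wX : ~~ in_X w) :
  op (F_incl w) = F_incl (F_bracket wX).
Proof.
rewrite /op /= /F_op; case: pselect => [/(F_incl_out wX) //|h].
apply: Some_inj; rewrite -!F_br_out.
exact: (@dl_lift_in _ (F_in X) _ (@F_br X) n w (@F_brS X)).
Qed.

Section AlphFmap.
Variables (X Y : choiceType) (phi : X -> Y).

Lemma alph_fmap0_out (w : word (alph X 0)) :
  ~~ in_X w -> ~~ in_X (word_map (phi : alph X 0 -> alph Y 0) w).
Proof.
apply: contra => /asboolP[y /(congr1 val)/=].
case: w => -[//|x [|//]] //= i _; apply/asboolP; exists x.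
exact: word_seq_inj.
Qed.

Fixpoint alph_fmap n : alph_map phi (alph X n) (alph Y n) :=
  match n with
  | 0 => @AlphMap X Y phi (alph X 0) (alph Y 0) phi (fun=> erefl)
           alph_fmap0_out
  | n'.+1 => next_map (alph_fmap n')
  end.

Definition F_fmap_ n : {multiplicative F_ X n -> F_ Y n} :=
  word_map (alph_fmap n).

Lemma alph_fmap_in n (a : alph X n) :
  alph_fmap n.+1 (alph_in X n a) = alph_in Y n (alph_fmap n a).
Proof.
elim: n a => [//|n ih] [x //|b]; congr inr; apply/val_inj/word_seq_inj => /=.
rewrite -!map_comp; apply: eq_map => a; exact: ih.
Qed.

Lemma F_fmap_in n (w : F_ X n) :
  F_fmap_ n.+1 (F_in X n w) = F_in Y n (F_fmap_ n w).
Proof.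
by apply: word_seq_inj; rewrite /= -!map_comp; apply: eq_map => a; apply: alph_fmap_in.
Qed.

Definition F_fmap : F X -> F Y := dl_lift (fun n w => F_incl (F_fmap_ n w)).

Lemma F_fmap_incl n (w : F_ X n) : F_fmap (F_incl w) = F_incl (F_fmap_ n w).
Proof.
by apply: dl_lift_in => m v; rewrite F_fmap_in /F_incl dl_inS.
Qed.

Lemma F_fmap_var x : F_fmap (F_var x) = F_var (phi x).
Proof. by rewrite F_fmap_incl; congr F_incl; apply: word_seq_inj. Qed.

Lemma F_fmapM : {morph F_fmap : u v / u * v}.
Proof.
move=> u v; have [[n [u' v']] /= [<- <-]] := dl_common u v.
by rewrite -gmulfM !F_fmap_incl gmulfM /F_incl gmulfM.
Qed.

End AlphFmap.

Lemma F_fmapP (X Y : opSetType) (phi : opset_hom X Y) :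
  {morph F_fmap phi : u / op u}.
Proof.
move=> u; rewrite -(dl_in_repr u).
move: (tag (repr u)) (tagged (repr u)) => n w.
have [/asboolP[x ->]|wX] := boolP (in_X w).
  by rewrite [dl_in _ _]F_incl_var F_op_var !F_fmap_var F_op_var opset_homP.
rewrite (F_op_bracket wX) !F_fmap_incl.
rewrite (F_op_bracket (alph_map_out (alph_fmap phi n) wX)).
by congr F_incl; apply: word_seq_inj; congr [:: inr _]; apply: val_inj.
Qed.

Lemma F_fmap_id (X : choiceType) : F_fmap id =1 @id (F X).
Proof.
have h n (a : alph X n) : alph_fmap id n a = a.
  elim: n a => [//|n ih] [x //|b]; congr inr; apply/val_inj/word_seq_inj => /=.
  by rewrite (eq_map ih) map_id.
move=> u; rewrite -(dl_in_repr u) F_fmap_incl; congr F_incl; apply: word_seq_inj => /=.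
by rewrite (eq_map (h _)); apply: map_id.
Qed.

Lemma F_fmap_comp (X Y Z : choiceType) (psi : Y -> Z) (phi : X -> Y) :
  F_fmap (psi \o phi) =1 F_fmap psi \o F_fmap phi.
Proof.
have h n (a : alph X n) :
    alph_fmap (psi \o phi) n a = alph_fmap psi n (alph_fmap phi n a).
  elim: n a => [//|n ih] [x //|b]; congr inr; apply/val_inj/word_seq_inj => /=.
  by rewrite (eq_map ih) map_comp.
move=> u; rewrite -(dl_in_repr u) [RHS]/=.
rewrite (F_fmap_incl phi) (F_fmap_incl psi) (F_fmap_incl (psi \o phi)).
congr F_incl; apply: word_seq_inj => /=.
by rewrite (eq_map (h _)); apply: map_comp.
Qed.

Definition free_opsem_obj (X : opSetType) : opSemigroupType := F X.

Definition free_opsem_hom (X Y : opSetType) (phi : opset_hom X Y) :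
  opsem_hom (F X) (F Y) := OpSemHom (@F_fmapM X Y phi) (F_fmapP phi).

Definition free_opsem : functor OpSetCat OpSemCat.
Proof.
refine (@Functor OpSetCat OpSemCat free_opsem_obj free_opsem_hom _ _).
- by move=> X; apply: opsem_hom_eq => u; apply: F_fmap_id.
- by move=> X Y Z psi phi; apply: opsem_hom_eq => u; apply: F_fmap_comp.
Defined.

(* Main.v *)
From mathcomp Require Import all_boot.
From mathcomp Require Import boolp.
Require Import Defs.

Set Implicit Arguments.
Unset Strict Implicit.
Unset Printing Implicit Defensive.

Local Open Scope group_scope.

(** The unit of the adjunction is the inclusion [F_var] of generators, which is
    a morphism of operated sets because the operator of [F X] extends that of
    [X].  The bijection of hom-sets is restriction along this unit, so what has
    to be shown is that every morphism [f] from [X] to an operated semigroup [S]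
    extends to [F X] in exactly one way.

    Uniqueness: [F X] is generated by [X] under product and operator, each letter
    of level [n.+1] being a generator or the operator applied to a word of level
    [n] ([F_ind]); hence two morphisms that agree on [X] agree everywhere
    ([opsem_hom_ext]).

    Existence: that same description of letters dictates the value of a letter,
    by recursion on the level ([letter_val]), and a word is sent to the product
    of the values of its letters.  These values do not change from one level to
    the next ([word_val_in]), so they descend to the direct limit.  The resulting
    map commutes with the operator because words outside [X] become brackets,
    whose value is an [op] by construction, while on [X] the operator is the one
    that [f] preserves ([lift_op]). *)

Section WordProd.
Variables (U : choiceType) (S : semigroupType).
Implicit Type g : U -> S.

(** Semigroups have no unit, so the fold starts from the value of the first
    letter, which nonemptiness of words provides. *)
Definition word_prod g (w : word U) : S :=
  match w with
  | Word s s_neq0 =>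
    match s return ~~ nilp s -> S with
    | [::] => fun nil_neq0 => False_rect S (elimN idP nil_neq0 isT)
    | a :: s' => fun=> foldl (fun p b => p * g b) (g a) s'
    end s_neq0
  end.

Lemma foldl_mull g x y s :
  foldl (fun p b => p * g b) (x * y) s = x * foldl (fun p b => p * g b) y s.
Proof. by elim: s y => //= a s ih y; rewrite -mulgA ih. Qed.

Lemma word_prodM g : {morph word_prod g : u v / u * v}.
Proof.
case=> [[//|a s] i] [[//|b t] j] /=.
by rewrite foldl_cat /= foldl_mull.
Qed.

Lemma eq_word_prod g h : g =1 h -> word_prod g =1 word_prod h.
Proof. by move=> /funext ->. Qed.

Lemma word_ind (P : word U -> Prop) :
  (forall a, P (word1 a)) -> (forall u v, P u -> P v -> P (u * v)) ->
  forall w, P w.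
Proof.
move=> P1 PM [[//|a s] i]; elim: s a i => [|b s ih] a i.
  by have -> : Word i = word1 a by apply: word_seq_inj.
have -> : Word i = word1 a * @Word _ (b :: s) isT by apply: word_seq_inj.
by apply: PM.
Qed.

End WordProd.

Lemma word_prod_map (U V : choiceType) (S : semigroupType) (h : U -> V)
    (g : V -> S) (w : word U) :
  word_prod g (word_map h w) = word_prod (g \o h) w.
Proof.
case: w => -[//|a s] i /=.
by elim: s (g (h a)) {i} => //= b s ih p; rewrite ih.
Qed.

Lemma F_ind (X : opSetType) (P : F X -> Prop) :
    (forall x, P (F_var x)) -> (forall u v, P u -> P v -> P (u * v)) ->
    (forall u, P u -> P (op u)) ->
  forall u, P u.
Proof.
move=> Pvar PM Pop u; rewrite -(dl_in_repr u) -/(F_incl _).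
elim: (tag _) (tagged _) => [|n ih]; apply: word_ind => [a|v w Pv Pw].
- exact: Pvar.
- by rewrite /F_incl gmulfM; apply: PM.
- case: a => [x|[w wX]]; first by rewrite (F_incl_var n.+1).
  (* a bracket letter is, in the limit, the operator applied to its content *)
  by have /= <- := F_op_bracket wX; apply/Pop/ih.
- by rewrite /F_incl gmulfM; apply: PM.
Qed.

Lemma opsem_hom_ext (X : opSetType) (S : opSemigroupType)
    (g h : opsem_hom (F X) S) :
  (forall x, g (F_var x) = h (F_var x)) -> g = h.
Proof.
move=> eq_gh; apply: opsem_hom_eq; apply: F_ind => // [u v gu gv|u gu].
  by rewrite !opsem_homM gu gv.
by rewrite !opsem_homP gu.
Qed.

Section Lift.
Variables (X : opSetType) (S : opSemigroupType).

Section Map.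
Variable f : X -> S.

(** The only value that an extension of [f] preserving product and operator can
    give to a letter. *)
Fixpoint letter_val n : alph X n -> S :=
  match n with
  | 0 => f
  | n'.+1 => fun a => match a with
             | inl x => f x
             | inr b => op (word_prod (@letter_val n') (sval b))
             end
  end.

Definition word_val n (w : F_ X n) : S := word_prod (@letter_val n) w.

Lemma letter_val_in n (a : alph X n) :
  letter_val (alph_in X n a : alph X n.+1) = letter_val a.
Proof.
elim: n a => [//|n ih] [x //|[w wX]]; congr op.
by rewrite [LHS]word_prod_map; apply: eq_word_prod => a; apply: ih.
Qed.

Lemma word_val_in n (w : F_ X n) : word_val (F_in X n w) = word_val w.
Proof.
rewrite /word_val [LHS]word_prod_map.
by apply: eq_word_prod => a; apply: letter_val_in.
Qed.

Definition lift : F X -> S := dl_lift word_val.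

Lemma lift_incl n (w : F_ X n) : lift (F_incl w) = word_val w.
Proof. by apply: dl_lift_in; apply: word_val_in. Qed.

Lemma lift_var x : lift (F_var x) = f x.
Proof. exact: lift_incl. Qed.

Lemma liftM : {morph lift : u v / u * v}.
Proof.
move=> u v; have [[n [u' v']] /= [<- <-]] := dl_common u v.
by rewrite -gmulfM !lift_incl; apply: word_prodM.
Qed.

End Map.

Variable f : opset_hom X S.

Lemma lift_op : {morph lift f : u / op u}.
Proof.
move=> u; rewrite -(dl_in_repr u) -/(F_incl _).
move: (tag _) (tagged _) => n w.
have [/asboolP[x ->]|wX] := boolP (in_X w).
  by rewrite F_incl_var F_op_var !lift_var opset_homP.
by rewrite (F_op_bracket wX) !lift_incl.
Qed.

Definition lift_hom : opsem_hom (F X) S := OpSemHom (liftM f) lift_op.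

End Lift.

Definition F_unit (X : opSetType) : opset_hom X (F X) :=
  OpSetHom (fun x => esym (F_op_var x)).

Theorem proposition2p7 : left_adjoint free_opsem forgetful.
Proof.
exists (fun X S g => opset_comp (opsem_forget g) (F_unit X)).
split=> [X S|X X' S S' h k f].
  exists (@lift_hom X S) => [g|f].
    by apply: opsem_hom_ext => x; apply: lift_var.
  by apply: opset_hom_eq => x; apply: lift_var.
by apply: opset_hom_eq => x /=; rewrite F_fmap_var.
Qed.
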